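(* If $G$ is a bipartite graph, then $$a(G)-\alpha(G)\leq \left\lfloor 2+\mu(G)-2\sqrt{1+\mu(G)}\right\rfloor ,$$ or equivalently $$a(G)-\alpha(G)\leq 2+\mu(G)-\left\lceil 2\sqrt{1+\mu(G)}\right\rceil .$$ Moreover, equality occurs for some connected bipartite graph on six vertices that is not a tree, and there are infinitely many pairwise non-isomorphic connected bipartite graphs that are not trees for which equality holds.
   Context: All graphs are finite, simple and undirected. For a graph $G$, $m(G)$ is the number of edges, $\alpha(G)$ is the independence number, and $\mu(G)$ is the matching number (maximum size of a set of pairwise disjoint edges). If $d_1\leq d_2\leq\cdots\leq d_n$ is the degree sequence of $G$, the annihilation number is $a(G)=\max\{k : \sum_{i=1}^k d_i\leq m(G)\}$. *)

(* Defs.v *)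
From mathcomp Require Import all_boot all_order all_algebra.
From mathcomp Require Import reals.

Set Implicit Arguments.
Unset Strict Implicit.
Unset Printing Implicit Defensive.

Record sgraph := SGraph {
  vertex :> finType;
  adj : rel vertex;
  adj_sym : symmetric adj;
  adj_irr : irreflexive adj }.

Definition edges (G : sgraph) : {set {set G}} :=
  [set [set x; y] | x in G, y in G & adj x y].

Definition num_edges (G : sgraph) : nat := #|edges G|.

Definition degree (G : sgraph) (x : G) : nat := #|[set y | adj x y]|.

Definition independent (G : sgraph) (S : {set G}) : bool :=
  [forall x in S, forall y in S, ~~ adj x y].

Definition independence_number (G : sgraph) : nat :=
  \max_(S : {set G} | independent S) #|S|.

Definition matching (G : sgraph) (M : {set {set G}}) : bool :=
  (M \subset edges G) && trivIset M.

Definition matching_number (G : sgraph) : nat :=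
  \max_(M : {set {set G}} | matching M) #|M|.

Definition degree_sequence (G : sgraph) : seq nat :=
  sort leq [seq degree x | x <- enum G].

(* k ranges over 0, ..., n with n the order of G; k = 0 is always admissible. *)
Definition annihilation_number (G : sgraph) : nat :=
  \max_(k < #|G|.+1 | sumn (take k (degree_sequence G)) <= num_edges G) k.

Definition bipartite (G : sgraph) : Prop :=
  exists A : {set G}, forall x y : G, adj x y -> (x \in A) != (y \in A).

(* The graph with no vertex is not connected. *)
Definition connected (G : sgraph) : Prop :=
  0 < #|G| /\ forall x y : G, connect (@adj G) x y.

(* Cycles have length at least 3: in path.v, an edge [:: x; y] traversed back
   and forth also satisfies ucycle. *)
Definition acyclic (G : sgraph) : Prop :=
  forall c : seq G, 2 < size c -> ~ ucycle (@adj G) c.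

Definition tree (G : sgraph) : Prop := connected G /\ acyclic G.

Definition isomorphic (G H : sgraph) : Prop :=
  exists2 f : G -> H, bijective f & forall x y : G, adj (f x) (f y) = adj x y.

Import GRing.Theory Num.Theory.
Local Open Scope ring_scope.

(* The difference is taken in int, not truncated. *)
Definition annihilation_gap (G : sgraph) : int :=
  (annihilation_number G)%:Z - (independence_number G)%:Z.

Definition floor_bound (R : realType) (G : sgraph) : int :=
  Num.floor (2 + (matching_number G)%:R
             - 2 * Num.sqrt (1 + (matching_number G)%:R) : R).

Definition ceil_bound (R : realType) (G : sgraph) : int :=
  2 + (matching_number G)%:Z
  - Num.ceil (2 * Num.sqrt (1 + (matching_number G)%:R) : R).

Definition extremal (R : realType) (G : sgraph) : Prop :=
  annihilation_gap G = floor_bound R G /\ annihilation_gap G = ceil_bound R G.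

(* Main.v *)
Require Import Defs.
From mathcomp Require Import all_boot all_order all_algebra.
From mathcomp Require Import reals.
From mathcomp Require Import zify.

(* Let T consist of the t = n - a(G) vertices of largest degree, so that T carries
   at least half of the total degree. Then no more edges avoid T than lie inside
   T, and bipartiteness bounds the latter by t^2/4; hence mu <= t + t^2/4, i.e.
   t >= 2 sqrt(1 + mu) - 2. Since alpha = n - mu by Konig's theorem,
   a - alpha = mu - t.
   For equality, take a perfect matching between two copies of a set of s^2 + 2s
   slots spread over levels 0, 1, 2 (s, s^2 and s slots), and also join the first
   copy of a slot to the second copy of any slot of higher level. Here
   mu = s^2 + 2s and t = 2s, T being level 0 of the first copy and level 2 of the
   second one; s = 1 gives a graph on six vertices. *)

Set Implicit Arguments.
Unset Strict Implicit.
Unset Printing Implicit Defensive.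

(** * König's theorem for families of two-element sets *)

Lemma card2_subset (V : finType) (e U : {set V}) (a b : V) :
  #|e| = 2 -> a \in e -> b \in e -> a != b -> a \in U -> b \in U ->
  e \subset U.
Proof.
move=> e2 ae be ab aU bU.
have <- : [set a; b] = e.
  by apply/eqP; rewrite eqEcard subUset !sub1set ae be cards2 ab e2.
by rewrite subUset !sub1set aU bU.
Qed.

(** Choosing a point of [T] in each member of [M] is injective, since the members are disjoint. *)
Lemma trivIset_leq_card (V : finType) (M : {set {set V}}) (T : {set V}) :
  trivIset M -> (forall e, e \in M -> e :&: T != set0) -> #|M| <= #|T|.
Proof.
move=> tM MT.
have [-> | [e0 e0M]] := set_0Vmem M; first by rewrite cards0.
have [x0 _] := set0Pn _ (MT _ e0M).
pose f (e : {set V}) := odflt x0 [pick x in e :&: T].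
have fP e : e \in M -> f e \in e :&: T.
  move=> /MT /set0Pn[x xe]; rewrite /f; case: pickP => //= /(_ x).
  by rewrite xe.
have finj : {in M &, injective f}.
  move=> e1 e2 e1M e2M fE; have := fP _ e1M; have := fP _ e2M.
  rewrite fE !inE => /andP[f2 _] /andP[f1 _].
  by rewrite -(def_pblock tM e1M f1) (def_pblock tM e2M f2).
rewrite -(card_in_imset finj); apply/subset_leq_card/subsetP => _ /imsetP[e eM ->].
by have := fP _ eM; rewrite inE => /andP[].
Qed.

Definition covers (V : finType) (C : {set V}) (E : {set {set V}}) : bool :=
  [forall e in E, e :&: C != set0].

Lemma coversP (V : finType) (C : {set V}) (E : {set {set V}}) :
  reflect (forall e, e \in E -> e :&: C != set0) (covers C E).
Proof. exact: forall_inP. Qed.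

(* De Caen's proof. Delete an edge if all covers keep size at least k. Otherwise
   every edge e has a cover of E :\ e of size less than k avoiding e; if E is not
   a matching, take such covers S, T for two edges meeting at x. The side of
   x |: (S (+) T) lying in A, or the one outside A, together with S :&: T is a
   cover of E that is too small. *)
Lemma konig (V : finType) (A : {set V}) (E : {set {set V}}) (k : nat) :
  (forall e, e \in E -> [/\ #|e| = 2, e :&: A != set0 & e :&: ~: A != set0]) ->
  (forall C : {set V}, covers C E -> k <= #|C|) ->
  exists M : {set {set V}}, [/\ M \subset E, trivIset M & k <= #|M|].
Proof.
have [n] := ubnP #|E|; elim: n E => // n IH E ltEn Eedge Ecov.
have [[e /andP[eE /forallP/= ecov]]|nocrit] :=
  altP (@existsP _ (fun e => (e \in E) &&
    [forall C : {set V}, covers C (E :\ e) ==> (k <= #|C|)])).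
  have [|||M [ME tM kM]] := IH (E :\ e).
  - by rewrite (cardsD1 e) eE in ltEn.
  - by move=> e'; rewrite inE => /andP[_]; apply: Eedge.
  - by move=> C Ccov; have := ecov C; rewrite Ccov.
  by exists M; split=> //; apply: (subset_trans ME); apply: subsetDl.
have crit e : e \in E ->
    exists C : {set V}, [/\ covers C (E :\ e), #|C| < k & e :&: C = set0].
  move=> eE; move: nocrit; rewrite negb_exists => /forallP/(_ e).
  rewrite eE negb_forall => /existsP[C]; rewrite negb_imply -ltnNge.
  case/andP=> Ccov Ck; exists C; split=> //.
  apply/eqP; apply: contraTT Ck => eC; rewrite -leqNgt; apply: Ecov.
  apply/coversP => e' e'E; have [->//|ne] := eqVneq e' e.
  by apply: (coversP _ _ Ccov); rewrite !inE ne.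
have e0 e : e \in E -> #|e| = 2 by case/Eedge.
have [tE|] := boolP (trivIset E).
  exists E; split=> //.
  have pE : partition E (cover E).
    rewrite /partition eqxx tE /=; apply/negP => /e0.
    by rewrite cards0.
  have trE := transversalP pE.
  (* A transversal has one vertex per edge, so it is a cover of size [#|E|]. *)
  rewrite -(card_transversal trE); apply: Ecov; apply/coversP => e eE.
  have /and3P[_ _ /forall_inP/(_ e eE)/cards1P[x Tx]] := trE.
  by apply/set0Pn; exists x; rewrite setIC Tx set11.
rewrite /trivIset => /trivIsetP; case=> e1 e2 e1E e2E ne12.
apply/negPn/negP => /pred0Pn[x /andP[/= xe1 xe2]].
have [S [Scov Sk S0]] := crit _ e1E.
have [T [Tcov Tk T0]] := crit _ e2E.
have notin (C e : {set V}) y : e :&: C = set0 -> y \in e -> y \notin C.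
  by move=> /setP/(_ y); rewrite !inE => h ye; move: h; rewrite ye /= => ->.
pose U := x |: ((S :\: T) :|: (T :\: S)).
(* Apart from [e1] and [e2], such an edge meets [S] and [T] in different vertices, one in [S :\: T]
   and one in [T :\: S]. For [e1] the ends are [x] and a vertex of [T :\: S]; [e2] is symmetric. *)
have UE e : e \in E -> e :&: (S :&: T) = set0 -> e \subset U.
  move=> eE eST.
  have [->|ne1] := eqVneq e e1.
    have /set0Pn[b] : e1 :&: T != set0.
      by apply: (coversP _ _ Tcov); rewrite !inE ne12.
    rewrite inE => /andP[be bT]; apply: (card2_subset (e0 _ e1E) xe1 be).
    - by apply: contraTneq bT => <-; apply: notin xe2.
    - by rewrite !inE eqxx.
    - by rewrite !inE bT (notin _ _ _ S0 be) !orbT.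
  have [->|ne2] := eqVneq e e2.
    have /set0Pn[b] : e2 :&: S != set0.
      by apply: (coversP _ _ Scov); rewrite !inE eq_sym ne12.
    rewrite inE => /andP[be bS]; apply: (card2_subset (e0 _ e2E) xe2 be).
    - by apply: contraTneq bS => <-; apply: notin xe1.
    - by rewrite !inE eqxx.
    - by rewrite !inE bS (notin _ _ _ T0 be) !orbT.
  have /set0Pn[a] : e :&: S != set0.
    by apply: (coversP _ _ Scov); rewrite !inE ne1.
  have /set0Pn[b] : e :&: T != set0.
    by apply: (coversP _ _ Tcov); rewrite !inE ne2.
  rewrite !inE => /andP[be bT] /andP[ae aS].
  have := notin _ _ _ eST ae; rewrite inE aS /= => aT.
  have := notin _ _ _ eST be; rewrite inE bT andbT => bS.
  apply: (card2_subset (e0 _ eE) ae be).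
  - by apply: contraNneq aT => ->.
  - by rewrite !inE aS aT orbT.
  - by rewrite !inE bT bS !orbT.
have side (B : {set V}) : (forall e, e \in E -> e :&: B != set0) ->
    k <= #|S :&: T| + #|U :&: B|.
  move=> EB; apply: leq_trans (leq_card_setU _ _); apply: Ecov.
  apply/coversP => e eE; rewrite setIUr setU_eq0 negb_and.
  have [/eqP eST|//] := boolP (e :&: (S :&: T) == set0).
  by rewrite setIA (setIidPl (UE _ eE eST)) EB ?orbT.
have kA : k <= #|S :&: T| + #|U :&: A| by apply: side => e /Eedge[].
have kA' : k <= #|S :&: T| + #|U :\: A| by rewrite setDE; apply: side => e /Eedge[].
(* Adding [kA] and [kA'] gives 2k <= 2|S ∩ T| + |U| <= 1 + |S| + |T| <= 2k - 1, a contradiction. *)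
have U1 : #|U| <= 1 + (#|S :\: T| + #|T :\: S|).
  rewrite /U; apply: leq_trans (leq_card_setU _ _) _; rewrite cards1 leq_add2l.
  exact: leq_card_setU.
have := cardsID A U; have := cardsID T S; have := cardsID S T.
by rewrite (setIC T S); lia.
Qed.

(** * Edges, degrees and matchings in graphs *)

Lemma edgesP (G : sgraph) (e : {set G}) :
  reflect (exists x y, adj x y /\ e = [set x; y]) (e \in edges G).
Proof.
apply: (iffP imset2P) => [[x y _]|[x [y [xy ->]]]].
  by rewrite !inE => xy ->; exists x, y.
by exists x y; rewrite // !inE.
Qed.

Lemma adj_neq (G : sgraph) (x y : G) : adj x y -> x != y.
Proof. by apply: contraTneq => ->; rewrite adj_irr. Qed.

Lemma card_edge (G : sgraph) (e : {set G}) : e \in edges G -> #|e| = 2.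
Proof. by case/edgesP=> x [y [/adj_neq xy ->]]; rewrite cards2 xy. Qed.

Lemma degreeE (G : sgraph) (x : G) : degree x = #|[set e in edges G | x \in e]|.
Proof.
have <- : [set [set x; y] | y in [set y | adj x y]] =
    [set e in edges G | x \in e].
  apply/setP => e; rewrite inE; apply/imsetP/andP => [[y]|[]].
    rewrite inE => xy ->; rewrite set21; split=> //.
    by apply/edgesP; exists x, y.
  case/edgesP => a [b [ab ->]]; rewrite !inE => /orP[] /eqP ->.
    by exists b; rewrite ?inE.
  by exists a; rewrite ?inE 1?adj_sym // setUC.
rewrite card_in_imset // => y z; rewrite !inE => xy xz /setP/(_ y).
rewrite !inE eqxx orbT => /esym/orP[] /eqP // yx.
by rewrite yx adj_irr in xy.
Qed.

Lemma sum_degree (G : sgraph) (T : {set G}) :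
  \sum_(x in T) degree x = \sum_(e in edges G) #|e :&: T|.
Proof.
under eq_bigr do rewrite degreeE -sum1dep_card big_mkcondr.
rewrite exchange_big; apply: eq_bigr => e _ /=.
by rewrite -big_mkcondr sum1dep_card; apply: eq_card => x; rewrite !inE andbC.
Qed.

Lemma handshake (G : sgraph) : \sum_(x : G) degree x = 2 * num_edges G.
Proof.
have := sum_degree [set: G].
under eq_bigl do rewrite in_setT; move=> ->.
under eq_bigr => e /card_edge e2 do rewrite setIT e2.
by rewrite sum_nat_const mulnC.
Qed.

Lemma independent_le (G : sgraph) (S : {set G}) :
  independent S -> #|S| <= independence_number G.
Proof. exact: (@leq_bigmax_cond _ _ (fun S : {set G} => #|S|)). Qed.

Lemma matching_le (G : sgraph) (M : {set {set G}}) :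
  matching M -> #|M| <= matching_number G.
Proof. exact: (@leq_bigmax_cond _ _ (fun M : {set {set G}} => #|M|)). Qed.

Lemma max_matching (G : sgraph) :
  exists2 M : {set {set G}}, matching M & #|M| = matching_number G.
Proof.
have P0 : matching (set0 : {set {set G}}).
  by rewrite /matching sub0set; apply/trivIsetP => e1 e2; rewrite inE.
have [M PM ME] := @eq_bigmax_cond _ (@matching G)
  (fun M : {set {set G}} => #|M|) (ltac:(apply/card_gt0P; exists set0; exact P0)).
by exists M.
Qed.

Lemma bipartite_edge (G : sgraph) (A e : {set G}) :
  (forall x y : G, adj x y -> (x \in A) != (y \in A)) -> e \in edges G ->
  exists x y, [/\ x \in A, y \notin A & e = [set x; y]].
Proof.
move=> bip /edgesP[x [y [xy ->]]]; have := bip _ _ xy.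
have [xA|xA] := boolP (x \in A); have [yA|yA] := boolP (y \in A) => // _.
  by exists x, y.
by exists y, x; rewrite setUC.
Qed.

(** The complement of a vertex cover is independent, so every cover has at least
    [#|G| - independence_number G] vertices. *)
Lemma bipartite_konig (G : sgraph) :
  bipartite G -> #|G| <= independence_number G + matching_number G.
Proof.
move=> [A bip].
have [e eE|C Ccov|M [ME tM kM]] :=
  @konig G A (edges G) (#|G| - independence_number G).
- split; first exact: card_edge.
    have [x [y [xA yA ->]]] := bipartite_edge bip eE.
    by apply/set0Pn; exists x; rewrite !inE eqxx.
  have [x [y [xA yA ->]]] := bipartite_edge bip eE.
  by apply/set0Pn; exists y; rewrite !inE eqxx orbT.
- rewrite leq_subLR -(cardsC C) addnC leq_add2r.
  apply: independent_le; apply/forall_inP => x; rewrite inE => xC.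
  apply/forall_inP => y; rewrite inE => yC; apply/negP => xy.
  have /(coversP _ _ Ccov)/set0Pn[z] : [set x; y] \in edges G.
    by apply/edgesP; exists x, y.
  by rewrite !inE => /andP[/orP[]/eqP-> ]; apply/negP.
- by rewrite -leq_subLR; apply: leq_trans kM (matching_le _); apply/andP.
Qed.

(* Comparing \sum_e #|e :&: T| with the number of edges, at most as many edges
   avoid T as lie inside T. So a matching has at most #|T| edges meeting T and
   #|T :&: A| * #|T :\: A| <= #|T|^2 / 4 edges avoiding T. *)
Lemma matching_number_bound (G : sgraph) (T : {set G}) :
  bipartite G -> num_edges G <= \sum_(x in T) degree x ->
  4 * (1 + matching_number G) <= (#|T| + 2) ^ 2.
Proof.
move=> [A bip]; rewrite sum_degree => mT.
have [M /andP[ME tM] <-] := max_matching G.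
pose E0 := [set e in edges G | e :&: T == set0].
pose E2 := [set e in edges G | e \subset T].
have E02 : #|E0| <= #|E2|.
  (* Edge by edge: |e ∩ T| + [e ∩ T = ∅] <= 1 + [e ⊆ T]. *)
  have : \sum_(e in edges G) #|e :&: T| + #|E0| <= num_edges G + #|E2|.
    rewrite /num_edges /E0 /E2 -!sum1dep_card !big_mkcondr -sum1_card /=.
    rewrite -!big_split; apply: leq_sum => e /card_edge e2 /=.
    have [->|_] := eqVneq (e :&: T) set0; first by rewrite cards0.
    have := subset_leq_card (subsetIl e T); rewrite e2 addn0.
    rewrite leq_eqVlt => /orP[/eqP eT2|eT2]; last first.
      exact: leq_trans eT2 (leq_addr _ _).
    suff -> : e \subset T by rewrite eT2.
    by apply/setIidPl/eqP; rewrite eqEcard subsetIl e2 eT2.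
  lia.
have E2T : #|E2| <= #|T :&: A| * #|T :\: A|.
  rewrite -cardsX.
  apply: leq_trans (leq_imset_card (fun p : G * G => [set p.1; p.2]) _).
  apply/subset_leq_card/subsetP => e; rewrite inE => /andP[eE eT].
  have [x [y [xA yA eq]]] := bipartite_edge bip eE.
  rewrite eq subUset !sub1set in eT; case/andP: eT => xT yT.
  by apply/imsetP; exists (x, y); rewrite // !inE /= xA yA xT yT.
have MT : #|M :\: E0| <= #|T|.
  apply: trivIset_leq_card => [|e]; first exact: trivIsetS (subsetDl _ _) tM.
  by rewrite !inE => /andP[+ /(subsetP ME) eE]; rewrite eE.
have M0 : #|M :&: E0| <= #|E0| by apply/subset_leq_card/subsetIr.
have := cardsID E0 M; have := cardsID A T.
(* With t = |T|, AM-GM bounds four times the product by t^2, and 4 + 4t + t^2 = (t + 2)^2. *)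
have [+ _] := nat_AGM2 #|T :&: A| #|T :\: A|.
by rewrite sqrnD; nia.
Qed.

(** * The annihilation number in terms of vertex sets *)

(** Let [d] be the largest of the first [k] sorted values. The truncated deficits [d - y] vanish on
    the remaining values, so the prefix has the whole deficit, and no set of [k] elements can fall
    further below [k * d]. *)
Lemma sumn_take_sort (T : finType) (f : T -> nat) (S : {set T}) :
  sumn (take #|S| (sort leq [seq f x | x <- enum T])) <= \sum_(x in S) f x.
Proof.
set s := sort _ _; set k := #|S|.
have ps : perm_eq s [seq f x | x <- enum T] by rewrite perm_sort.
have szk : size (take k s) = k.
  by rewrite size_takel // size_sort size_map -cardE max_card.
have : sorted leq s by apply: sort_sorted; apply: leq_total.
rewrite (sorted_pairwise leq_trans) -{1}(cat_take_drop k s) pairwise_cat.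
case/and3P=> /allrelP sle _ _.
pose d := \max_(y <- take k s) y.
have dtake : \sum_(y <- take k s) y + \sum_(y <- take k s) (d - y) = k * d.
  rewrite -big_split /= -[in RHS]szk -sum1_size big_distrl /=.
  rewrite [in LHS]big_seq [in RHS]big_seq; apply: eq_bigr => y ys.
  by rewrite subnKC ?mul1n //; apply: (@leq_bigmax_seq _ _ xpredT id).
have ddrop : \sum_(y <- drop k s) (d - y) = 0.
  rewrite big_seq big1 // => y ys; apply/eqP; rewrite subn_eq0.
  by apply/bigmax_leqP_seq => z zs _; apply: sle.
have dS : k * d <= \sum_(x in S) f x + \sum_(x in S) (d - f x).
  by rewrite -big_split /= -sum_nat_const; apply: leq_sum => x _; lia.
have dT : \sum_(x in S) (d - f x) <= \sum_(y <- take k s) (d - y).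
  suff -> : \sum_(y <- take k s) (d - y) = \sum_(x : T) (d - f x).
    by rewrite [leqRHS](bigID (mem S)) /= leq_addr.
  have -> : \sum_(x : T) (d - f x) = \sum_(y <- s) (d - y).
    by rewrite (perm_big _ ps) big_map big_enum.
  by rewrite -{2}(cat_take_drop k s) big_cat /= ddrop addn0.
by rewrite sumnE; lia.
Qed.

Lemma annihilation_ge (G : sgraph) (S : {set G}) :
  \sum_(x in S) degree x <= num_edges G -> #|S| <= annihilation_number G.
Proof.
move=> Sm; have Sn : #|S| < #|G|.+1 by rewrite ltnS max_card.
apply: (@leq_bigmax_cond _ _ (@nat_of_ord _) (Ordinal Sn)) => /=.
exact: leq_trans (sumn_take_sort _ _) Sm.
Qed.

(** Sorting the vertices themselves by degree makes the tail after the optimal prefix a vertex set.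
    The prefix has total degree at most m out of 2m, leaving at least m to the tail. *)
Lemma annihilation_complement (G : sgraph) :
  exists T : {set G}, #|T| + annihilation_number G = #|G| /\
    num_edges G <= \sum_(x in T) degree x.
Proof.
have [|k Pk kE] := @eq_bigmax_cond _ [pred k : 'I_#|G|.+1 |
  sumn (take k (degree_sequence G)) <= num_edges G] (@nat_of_ord _).
  by apply/card_gt0P; exists ord0; rewrite inE take0.
have {kE}-> : annihilation_number G = k := kE.
pose r := sort (relpre (@degree G) leq) (enum G).
have rE : degree_sequence G = map (@degree G) r by rewrite -sort_map.
have ur : uniq r by rewrite sort_uniq enum_uniq.
have sr : size r = #|G| by rewrite size_sort -cardE.
exists [set x in drop k r]; split.
  rewrite cardsE (card_uniqP _) ?drop_uniq // size_drop sr subnK //.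
  by rewrite -ltnS.
move: Pk; rewrite inE rE -map_take sumnE big_map => Pk.
have : \sum_(x in [set x in drop k r]) degree x = \sum_(x <- drop k r) degree x.
  by under eq_bigl do rewrite inE; rewrite -big_uniq ?drop_uniq.
have : \sum_(x <- r) degree x = 2 * num_edges G.
  rewrite -handshake -[RHS]big_enum /=.
  by apply: perm_big; rewrite perm_sort.
rewrite -{1}(cat_take_drop k r) big_cat /= => dE ->.
by rewrite -(leq_add2l (\sum_(x <- take k r) degree x)) dE mul2n -addnn leq_add2r.
Qed.

(** * The extremal family *)

(** The edges [M i] partition the vertices. A matching covers two vertices per edge, and an
    independent set has at most one vertex in each [M i]. *)
Lemma perfect_matching_bounds (G : sgraph) (I : finType) (M : I -> {set G}) :
  (forall i, M i \in edges G) -> (forall i j x, x \in M i -> x \in M j -> i = j) ->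
  #|G| = 2 * #|I| -> matching_number G = #|I| /\ independence_number G <= #|I|.
Proof.
move=> Medge Mdisj cardG.
have Minj : injective M.
  move=> i j Mij; have : M i != set0 by rewrite -cards_eq0 (card_edge (Medge i)).
  by case/set0Pn=> x xi; apply: (Mdisj i j x) => //; rewrite -Mij.
have matM : matching (M @: setT).
  apply/andP; split; first by apply/subsetP => _ /imsetP[i _ ->].
  apply/trivIsetP => _ _ /imsetP[i _ ->] /imsetP[j _ ->] neq.
  apply/pred0P => x; apply/negP => /andP[/= xi xj].
  by case/eqP: neq; rewrite (Mdisj _ _ _ xi xj).
split.
  apply/eqP; rewrite eqn_leq; apply/andP; split.
    have [N /andP[/subsetP NE /eqP tN] <-] := max_matching G.
    rewrite -(leq_pmul2l (isT : 0 < 2)) -cardG mulnC -sum_nat_const.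
    rewrite (eq_bigr (fun e : {set G} => #|e|)); last first.
      by move=> e /NE/card_edge->.
    by rewrite tN max_card.
  by rewrite -(cardsT I) -(card_imset _ Minj) matching_le.
have cM : cover (M @: setT) = setT.
  apply/eqP; rewrite eqEcard subsetT cardsT cardG.
  have [_ /eqP<-] := andP matM.
  rewrite big_imset /=; last by move=> i j _ _; apply: Minj.
  under eq_bigr do rewrite (card_edge (Medge _)).
  by rewrite sum_nat_const cardsT mulnC.
apply/bigmax_leqP => S /forall_inP indS.
rewrite -(cardsT I) -(card_imset _ Minj).
have [_ tM] := andP matM.
pose f x := pblock (M @: setT) x.
have inf x : x \in f x by rewrite mem_pblock cM inE.
have fM x : f x \in M @: setT by rewrite pblock_mem // cM inE.
have finj : {in S &, injective f}.
  move=> x y xS yS fxy; apply/eqP/negPn/negP => xy.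
  have /imsetP[i _ fi] := fM x.
  have /edgesP[a [b [ab eab]]] := Medge i.
  have := inf y; have := inf x; rewrite -fxy fi eab !inE.
  move: (forall_inP (indS _ xS) _ yS) (forall_inP (indS _ yS) _ xS) xy.
  by move=> nxy nyx xy /orP[]/eqP xE /orP[]/eqP yE; subst;
     rewrite ?ab ?eqxx in nxy nyx xy.
rewrite -(card_in_imset finj); apply/subset_leq_card/subsetP => _ /imsetP[x _ ->].
exact: fM.
Qed.

Section Family.
Variable s : nat.

(* A vertex is a pair of a side (false or true) and a slot. The core of 2s vertices
   is level 0 on side false together with level 2 on side true. *)
Definition slot : finType := ('I_s + 'I_(s * s) + 'I_s)%type.

Definition level (c : slot) : nat :=
  match c with inl (inl _) => 0 | inl (inr _) => 1 | inr _ => 2 end.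

Definition slot_le (c d : slot) : bool := (c == d) || (level c < level d).

(** Both branches test that the slot on side [false] is below the one on side [true], whichever
    vertex comes first. *)
Definition layered_adj (u v : bool * slot) : bool :=
  (u.1 != v.1) && (if u.1 then slot_le v.2 u.2 else slot_le u.2 v.2).

Lemma layered_adj_sym : symmetric layered_adj.
Proof. by move=> [[] c] [[] d]. Qed.

Lemma layered_adj_irr : irreflexive layered_adj.
Proof. by move=> [[] c]. Qed.

Definition layered : sgraph := SGraph layered_adj_sym layered_adj_irr.

Lemma card_slot : #|slot| = s * s + 2 * s.
Proof. by rewrite !card_sum !card_ord; lia. Qed.

Lemma card_layered : #|layered| = 2 * #|slot|.
Proof. by rewrite card_prod card_bool. Qed.

Lemma layered_bipartite : bipartite layered.
Proof.
exists [set v : layered | v.1] => u v; rewrite !inE.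
by case/andP.
Qed.

Lemma layered_perfect :
  matching_number layered = #|slot| /\ independence_number layered <= #|slot|.
Proof.
pose M (c : slot) : {set layered} := [set (false, c); (true, c)].
apply: (@perfect_matching_bounds _ _ M) card_layered => [c|c d x].
  apply/edgesP; exists (false, c), (true, c); split=> //.
  by rewrite /= /layered_adj /slot_le /= eqxx.
by rewrite !inE => /orP[]/eqP-> /orP[]/eqP[].
Qed.

Lemma sum_slot (f : slot -> nat) :
  \sum_c f c = \sum_i f (inl (inl i)) + \sum_j f (inl (inr j)) + \sum_k f (inr k).
Proof. by rewrite !big_sumType. Qed.

Lemma sum_layered (f : layered -> nat) :
  \sum_v f v = \sum_c f (false, c) + \sum_c f (true, c).
Proof.
have -> : \sum_v f v = \sum_(b : bool) \sum_c f (b, c).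
  by rewrite pair_big; apply: eq_bigr => -[].
by rewrite big_bool addnC.
Qed.

Lemma degree_layered (b : bool) (c : slot) :
  degree ((b, c) : layered) =
    1 + \sum_d ((if b then level d < level c else level c < level d) : nat).
Proof.
have one : \sum_d ((d == c) : nat) = 1.
  by rewrite (bigD1 c) //= eqxx big1 // => d /negPf->.
rewrite -{}one -big_split /degree -sum1dep_card big_mkcond sum_layered.
case: b => /=.
  rewrite [X in _ + X = _]big1 // addn0; apply: eq_bigr => d _.
  rewrite /layered_adj /slot_le /=.
  by have [->|_] := eqVneq d c; [rewrite ltnn | case: ltnP].
rewrite big1 // add0n; apply: eq_bigr => d _.
rewrite /layered_adj /slot_le /= eq_sym.
by have [->|_] := eqVneq d c; [rewrite ltnn | case: ltnP].
Qed.

(** The 1 counts the matching edge. The cases are the middle level, the leaves (levels 0 and 2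
    outside the core) and the core. *)
Definition layered_degree (v : layered) : nat :=
  1 + (if level v.2 == 1 then s
       else if v.1 == (level v.2 == 0) then 0 else s * s + s).

Lemma degree_layeredE (v : layered) : degree v = layered_degree v.
Proof.
case: v => b c; rewrite degree_layered sum_slot /layered_degree.
by case: b c => -[[i|j]|k] /=; rewrite !sum_nat_const !card_ord; lia.
Qed.

(* The vertices outside the core; they carry exactly half of the total degree. *)
Definition outer (v : layered) : bool := level v.2 != (if v.1 then 2 else 0).

Lemma sum_outer (f : layered -> nat) :
  \sum_(v in [set v | outer v]) f v =
  \sum_j f (false, inl (inr j)) + \sum_k f (false, inr k) +
  (\sum_i f (true, inl (inl i)) + \sum_j f (true, inl (inr j))).
Proof.
under eq_bigl do rewrite inE.
by rewrite big_mkcond sum_layered !sum_slot /outer /= !big1_eq add0n addn0.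
Qed.

Lemma layered_annihilation : s * s + #|slot| <= annihilation_number layered.
Proof.
have -> : s * s + #|slot| = #|[set v : layered | outer v]|.
  rewrite -sum1_card sum_outer card_slot !sum_nat_const !card_ord; lia.
apply: annihilation_ge.
(* After doubling, the claim compares total degrees; outer vertices and core each contribute 2s(s^2
   + s + 1). *)
rewrite -(leq_pmul2l (isT : 0 < 2)) -handshake.
rewrite !(eq_bigr _ (fun v _ => degree_layeredE v)).
rewrite sum_outer sum_layered !sum_slot /layered_degree /= !sum_nat_const !card_ord.
nia.
Qed.

(** The adjacent vertices [low] and [high] dominate all but the leaves, and each leaf hangs on a
    core vertex by its matching edge. *)
Lemma layered_connected : 0 < s -> connected layered.
Proof.
move=> s_gt0.
pose low : layered := (false, inl (inl (Ordinal s_gt0))).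
pose high : layered := (true, inr (Ordinal s_gt0)).
have csym : connect_sym (@adj layered) by apply/sym_connect_sym/adj_sym.
have low_high : connect (@adj layered) low high by apply: connect1.
have to_low (v : layered) : connect (@adj layered) low v.
  have same c : @adj layered (true, c) (false, c).
    by rewrite /= /layered_adj /slot_le /= eqxx.
  case: v => -[] [[i|j]|k]; try by apply: connect1.
  - apply: connect_trans low_high _; rewrite csym.
    by apply: (@connect_trans _ _ (false, inl (inl i))); apply: connect1.
  - by apply: (connect_trans low_high); apply: connect1.
  - by apply: (connect_trans low_high); apply: connect1.
  - apply: (@connect_trans _ _ (true, inr k)); apply: connect1 => //.
split; first by rewrite card_layered card_slot; lia.
move=> u v; apply: connect_trans (to_low v); rewrite csym; exact: to_low.
Qed.

(** A middle matching edge closes a 4-cycle with the edge from [low] to [high]. *)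
Lemma layered_not_tree : 0 < s -> ~ tree layered.
Proof.
move=> s_gt0 [_ acyc].
pose low : layered := (false, inl (inl (Ordinal s_gt0))).
pose high : layered := (true, inr (Ordinal s_gt0)).
pose mid (b : bool) : layered :=
  (b, inl (inr (Ordinal (leq_mul s_gt0 s_gt0 : 0 < s * s)))).
by apply: (acyc [:: low; mid true; mid false; high]).
Qed.

End Family.

(** * The real bounds and equality *)

Local Open Scope ring_scope.
Import Order.TTheory GRing.Theory Num.Theory.

Lemma floor_bound_ceil (R : realType) (G : sgraph) :
  floor_bound R G = ceil_bound R G.
Proof.
rewrite /floor_bound /ceil_bound -[2 + _%:R](natrD _ 2 (matching_number G)) pmulrn.
by rewrite floorDzr ?intr_int // (floorNceil (- _)) opprK intrKfloor.
Qed.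

Lemma annihilation_gap_le (R : realType) (G : sgraph) :
  bipartite G -> annihilation_gap G <= ceil_bound R G.
Proof.
move=> bip; have [T [aT mT]] := annihilation_complement G.
have konG := bipartite_konig bip.
have T2 := matching_number_bound bip mT.
have sqrt_le : 2 * Num.sqrt (1 + (matching_number G)%:R : R) <= (#|T| + 2)%N%:~R.
  rewrite -(@ler_pXn2r _ 2) ?nnegrE ?mulr_ge0 ?sqrtr_ge0 ?ler0z //.
  rewrite exprMn sqr_sqrtr ?addr_ge0 // -natrX -[_ ^+ 2%N]natrX -[1]/(1%:R).
  by rewrite -natrD -natrM ler_nat.
(* The integer |T| + 2 also bounds the ceiling, and the gap is at most mu - |T|. *)
have := sqrt_le; rewrite -ceil_le_int /annihilation_gap /ceil_bound.
move: (Num.ceil _) => c; lia.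
Qed.

Lemma layered_extremal (R : realType) (s : nat) : extremal R (layered s).
Proof.
rewrite /extremal floor_bound_ceil.
suff : annihilation_gap (layered s) = ceil_bound R (layered s) by [].
apply: le_anti; rewrite (annihilation_gap_le R (layered_bipartite s)) /=.
have [muE alpha] := layered_perfect s.
(* Here 1 + mu = (s + 1)^2, so the bound is exactly s^2, which the gap reaches. *)
have sqrtE : Num.sqrt (1 + (matching_number (layered s))%:R : R) = s.+1%:R.
  rewrite muE card_slot -(natrD _ 1) (_ : (1 + _ = s.+1 ^ 2)%N); last by lia.
  by rewrite natrX sqrtr_sqr ger0_norm.
have := layered_annihilation s.
rewrite /ceil_bound sqrtE -natrM [X in Num.ceil X]pmulrn intrKceil muE /annihilation_gap.
rewrite card_slot in alpha *; lia.
Qed.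

Theorem theoremD (R : realType) :
  (forall G : sgraph, bipartite G ->
     annihilation_gap G <= floor_bound R G /\
     annihilation_gap G <= ceil_bound R G) /\
  (exists G : sgraph,
     [/\ #|G| = 6%N, connected G, bipartite G, ~ tree G & extremal R G]) /\
  (exists F : nat -> sgraph,
     (forall i : nat,
        [/\ connected (F i), bipartite (F i), ~ tree (F i) &
            extremal R (F i)]) /\
     (forall i j : nat, i <> j -> ~ isomorphic (F i) (F j))).
Proof.
have cardF s : #|layered s| = (2 * (s * s + 2 * s))%N.
  by rewrite card_layered card_slot.
split=> [G bip|]; first by rewrite floor_bound_ceil; split; apply: annihilation_gap_le.
(* The shift [i.+1] skips the empty graph [layered 0]; distinct orders rule out isomorphisms. *)
split; [exists (layered 1) | exists (fun i => layered i.+1)].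
  split; [by rewrite cardF | exact: layered_connected | exact: layered_bipartite
         | exact: layered_not_tree | exact: layered_extremal].
split=> [i | i j ij [f /bij_eq_card]]; last by rewrite !cardF; nia.
by split; [exact: layered_connected | exact: layered_bipartite
          | exact: layered_not_tree | exact: layered_extremal].
Qed.
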